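(* Let $(X,d)$ be a compact metric space and let $\phi$ be a continuous flow on $X$ having shadowable points, i.e. $Sh(\phi)\ne\emptyset$. Then $\phi$ is chain transitive if and only if $\phi$ is transitive.
   Context: A flow on $X$ is a map $\phi:X\times\mathbb{R}\to X$ with $\phi(x,0)=x$ and $\phi(\phi(x,s),t)=\phi(x,s+t)$, assumed continuous; $\phi_t(x)=\phi(x,t)$. The flow is transitive if there is $x\in X$ with $\omega(x)=X$, where $\omega(x)=\{y\in X: y=\lim_{n\to\infty}\phi_{t_n}(x)\text{ for some sequence }t_n\to+\infty\}$. Given $\delta,T>0$, a $(\delta,T)$-chain is a finite sequence $(x_i,t_i)_{i=0}^m$ in $X\times\mathbb{R}$ with $t_i\ge T$ and $d(\phi_{t_i}(x_i),x_{i+1})\le\delta$ for $0\le i\le m-1$. Points $p,q$ are $(\delta,T)$-related if there are $(\delta,T)$-chains $(x_i,t_i)_{i=0}^m$ and $(y_i,u_i)_{i=0}^n$ with $m,n\ge1$, $p=x_0=y_n$ and $q=y_0=x_m$; $p\sim q$ means they are $(\delta,T)$-related for all $\delta,T>0$. The flow is chain transitive if $p\sim q$ for all $p,q\in X$. A $(\delta,T)$-pseudo-orbit is a sequence $(x_i,t_i)_{i\in\mathbb{Z}}$ in $X\times\mathbb{R}$ with $t_i\ge T$ and $d(\phi_{t_i}(x_i),x_{i+1})\le\delta$ for all $i\in\mathbb{Z}$. It passes through $p$ if $x_0=p$. Put $s_0=0$, $s_i=\sum_{j=0}^{i-1}t_j$ for $i>0$, $s_i=-\sum_{j=i}^{-1}t_j$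 for $i<0$, and $x_0\star t=\phi_{t-s_i}(x_i)$ whenever $s_i\le t<s_{i+1}$. $\mathrm{Rep}$ is the set of surjective strictly increasing maps $h:\mathbb{R}\to\mathbb{R}$ with $h(0)=0$. The pseudo-orbit is $\varepsilon$-shadowed if there are $y\in X$ and $h\in\mathrm{Rep}$ with $d(x_0\star t,\phi_{h(t)}(y))\le\varepsilon$ for all $t\in\mathbb{R}$. A point $p\in X$ is shadowable if for every $\varepsilon>0$ there is $\delta>0$ such that every $(\delta,1)$-pseudo-orbit passing through $p$ is $\varepsilon$-shadowed; $Sh(\phi)$ is the set of shadowable points. *)

(* Defs.v *)
From mathcomp Require Import all_boot all_order all_algebra.
From mathcomp Require Import all_classical all_reals all_analysis.

Set Implicit Arguments.
Unset Strict Implicit.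
Unset Printing Implicit Defensive.

Import Order.TTheory GRing.Theory Num.Theory.
Import numFieldNormedType.Exports.

Local Open Scope classical_set_scope.
Local Open Scope ring_scope.

Definition is_flow (R : realType) (X : metricType R) (phi : X * R -> X) : Prop :=
  [/\ continuous phi,
      forall x, phi (x, 0) = x &
      forall x s t, phi (phi (x, s), t) = phi (x, s + t)].

Definition omega (R : realType) (X : metricType R) (phi : X * R -> X) (x : X) :
    set X :=
  [set y | exists2 t : nat -> R, t @ \oo --> +oo &
                                 (fun n => phi (x, t n)) @ \oo --> y].

Definition transitive_flow (R : realType) (X : metricType R)
    (phi : X * R -> X) : Prop :=
  exists x, omega phi x = [set: X].

(* The finite sequence (x_i, t_i), 0 <= i <= m, is given by c i = (x_i, t_i);
   the values of c beyond m are irrelevant. *)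
Definition chain (R : realType) (X : metricType R) (phi : X * R -> X)
    (delta T : R) (m : nat) (c : nat -> X * R) : Prop :=
  forall i : nat, (i < m)%N ->
    T <= (c i).2 /\ mdist (phi ((c i).1, (c i).2)) (c i.+1).1 <= delta.

Definition related (R : realType) (X : metricType R) (phi : X * R -> X)
    (delta T : R) (p q : X) : Prop :=
  exists (m n : nat) (c e : nat -> X * R),
    [/\ (1 <= m)%N /\ (1 <= n)%N,
        chain phi delta T m c, chain phi delta T n e,
        p = (c 0%N).1 /\ p = (e n).1 &
        q = (e 0%N).1 /\ q = (c m).1].

Definition chain_equiv (R : realType) (X : metricType R) (phi : X * R -> X)
    (p q : X) : Prop :=
  forall delta T : R, 0 < delta -> 0 < T -> related phi delta T p q.

Definition chain_transitive (R : realType) (X : metricType R)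
    (phi : X * R -> X) : Prop :=
  forall p q, chain_equiv phi p q.

Definition pseudo_orbit (R : realType) (X : metricType R) (phi : X * R -> X)
    (delta T : R) (c : int -> X * R) : Prop :=
  forall i : int,
    T <= (c i).2 /\ mdist (phi ((c i).1, (c i).2)) (c (i + 1)).1 <= delta.

(* s_i. As Negz n = - n.+1, the second branch sums over
   j = -1, ..., - n.+1. *)
Definition partial_time (R : realType) (X : metricType R) (c : int -> X * R)
    (i : int) : R :=
  match i with
  | Posz n => \sum_(0 <= j < n) (c (Posz j)).2
  | Negz n => - \sum_(0 <= k < n.+1) (c (Negz k)).2
  end.

(* The index i is unique, by star_phiE below; xget returns the default index 0
   only if there is none, which cannot happen for a (delta, T)-pseudo-orbit
   with T > 0, by star_index_exists. *)
Definition star_index (R : realType) (X : metricType R) (c : int -> X * R)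
    (t : R) : int :=
  xget 0 [set i : int | partial_time c i <= t < partial_time c (i + 1)].

Definition star (R : realType) (X : metricType R) (phi : X * R -> X)
    (c : int -> X * R) (t : R) : X :=
  let i := star_index c t in phi ((c i).1, t - partial_time c i).

Definition Rep (R : realType) : set (R -> R) :=
  [set h | [/\ set_surj [set: R] [set: R] h, {homo h : x y / x < y} &
               h 0 = 0]].

Definition shadowed (R : realType) (X : metricType R) (phi : X * R -> X)
    (eps : R) (c : int -> X * R) : Prop :=
  exists (y : X) (h : R -> R), Rep h /\
    forall t : R, mdist (star phi c t) (phi (y, h t)) <= eps.

Definition shadowable (R : realType) (X : metricType R) (phi : X * R -> X)
    (p : X) : Prop :=
  forall eps : R, 0 < eps -> exists2 delta : R, 0 < delta &
    forall c : int -> X * R, pseudo_orbit phi delta 1 c -> (c 0).1 = p ->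
      shadowed phi eps c.

Definition Sh (R : realType) (X : metricType R) (phi : X * R -> X) : set X :=
  [set p | shadowable phi p].

Lemma partial_timeS (R : realType) (X : metricType R) (c : int -> X * R)
    (i : int) : partial_time c (i + 1) = partial_time c i + (c i).2.
Proof.
case: i => n.
  by rewrite -PoszD addn1 /= big_nat_recr.
case: n => [|n]; first by rewrite /= big_nat1 big_nil addNr.
have -> : Negz n.+1 + 1 = Negz n by rewrite !NegzE -[n.+2]addn1 PoszD opprD addrNK.
by rewrite /= [in RHS]big_nat_recr //= opprD addrNK.
Qed.

Section PseudoOrbit.
Context (R : realType) (X : metricType R) (phi : X * R -> X) (delta T : R).
Context (c : int -> X * R).
Hypotheses (T0 : 0 < T) (hc : pseudo_orbit phi delta T c).

Let partial_time_le (i : int) (n : nat) :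
  partial_time c i + T *+ n <= partial_time c (i + n%:Z).
Proof.
elim: n => [|n ih]; first by rewrite mulr0n !addr0.
rewrite -[n.+1]addn1 PoszD addrA partial_timeS mulrnDr mulr1n addrA.
by rewrite lerD// (hc _).1.
Qed.

Lemma star_phiE (i : int) (t : R) :
  partial_time c i <= t < partial_time c (i + 1) ->
  star phi c t = phi ((c i).1, t - partial_time c i).
Proof.
have mono (j k : int) : (j <= k)%R -> partial_time c j <= partial_time c k.
  move=> jk; have -> : k = j + `|k - j|%N by rewrite gez0_abs ?subr_ge0// subrKC.
  apply: le_trans (partial_time_le _ _).
  by rewrite lerDl mulrn_wge0// ltW.
move=> hi; rewrite /star /star_index.
have := @xgetI _ 0 [set i : int | partial_time c i <= t < partial_time c (i + 1)] i hi.
set j := xget _ _ => /= hj.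
suff -> : j = i by [].
have aux (k l : int) : partial_time c k <= t -> t < partial_time c (l + 1) -> k <= l.
  move=> kt tl; rewrite leNgt; apply/negP => lk.
  have /mono : (l + 1 <= k)%R by rewrite lezD1.
  by rewrite leNgt (le_lt_trans kt tl).
case/andP: hi => i1 i2; case/andP: hj => j1 j2.
by apply/eqP; rewrite eq_le !aux.
Qed.

Lemma star_index_exists (t : R) :
  exists i : int, partial_time c i <= t < partial_time c (i + 1).
Proof.
pose N := (Num.truncn (`|t| / T)).+1.
have tN : `|t| < T *+ N.
  rewrite -mulr_natr mulrC -ltr_pdivrMr// /N.
  by rewrite truncnS_gt.
have lo : partial_time c (- N%:Z) <= t.
  have := partial_time_le (- N%:Z) N; rewrite addNr /= big_nil.
  rewrite -lerBrDr sub0r => /le_trans; apply.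
  by move: tN; rewrite ltr_norml => /andP[/ltW].
have [n tn] : exists n : nat, t < partial_time c (- N%:Z + n%:Z).
  exists (N + N)%N; rewrite PoszD addrA addNr.
  have := partial_time_le 0 N; apply: lt_le_trans.
  by rewrite /= big_nil add0r (le_lt_trans (ler_norm _)).
elim: n tn => [|n ih] tn.
  by move: tn; rewrite addr0 ltNge lo.
have [/ih//|tn'] := ltP t (partial_time c (- N%:Z + n%:Z)).
exists (- N%:Z + n%:Z); rewrite tn' /=.
by move: tn; rewrite -[n.+1]addn1 PoszD addrA.
Qed.

End PseudoOrbit.

(* Main.v *)
From HB Require Import structures.
Require Import Defs.
From mathcomp Require Import all_boot all_order all_algebra.
From mathcomp Require Import all_classical all_reals all_analysis.

Set Implicit Arguments.
Unset Strict Implicit.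
Unset Printing Implicit Defensive.

Import Order.TTheory GRing.Theory Num.Theory.
Import numFieldNormedType.Exports.
Local Open Scope classical_set_scope.
Local Open Scope ring_scope.

(** Let [phi] be chain transitive with a shadowable point [p], and let [x], [y]
be any two points. Chains from [p] to [x], from [x] to [y] and from [y] back to
[p] close up into a periodic pseudo-orbit through [p], with jumps as small as
desired. An orbit shadowing it passes close to [x], and close to [y] at
arbitrarily late times, since the pseudo-orbit returns to [y] once per period
and a reparametrization, being increasing and onto, is unbounded. So near
every point there are points whose orbit visits a given open set arbitrarily
late: this is [shadowable_topologically_transitive]. Only one shadowable point
is needed because every pseudo-orbit to be shadowed can be routed through it.

Passing from dense sets of such points to a single point [x] with
[omega phi x = [set: X]] is a Baire category argument. The points which after
time [n] visit the ball of radius [1 / (n + 1)] around each member of a finite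
[1 / (n + 1)]-net form a dense open set ([dense_reaches_all]), and a point that
lies in all these sets has the whole of [X] as its omega-limit set
([topologically_transitive_transitive]).

Conversely, if [omega phi x = [set: X]], then any [p] and [q] are joined by a
chain with two jumps: from the orbit of [p] onto the orbit of [x], and from
there to [q] after a long enough time ([transitive_chained]). *)

(** * Baire category in compact spaces *)

(** Regularity provides nonempty open sets [V n] with
[closure (V n.+1) `<=` V n `&` O n]; points picked in the [V n] have a cluster
point by compactness, and it lies in the closure of every [V n]. *)
Lemma compact_hausdorff_Baire (T : topologicalType) (O : nat -> set T) :
  hausdorff_space T -> compact [set: T] ->
  (forall n, open (O n) /\ dense (O n)) -> dense (\bigcap_n O n).
Proof.
move=> hT cT hO D D0 oD.
pose good := [set U : set T | U !=set0 /\ open U].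
(* The choice of the next open set, made total so that [choice] applies. *)
have step (nU : nat * set T) : exists V, good nU.2 ->
    good V /\ closure V `<=` nU.2 `&` O nU.1.
  have [[U0 oU]|] := pselect (good nU.2); last by exists set0.
  have [oOn dOn] := hO nU.1.
  have [x [Ux Ox]] := dOn _ U0 oU.
  have nx : nbhs x (nU.2 `&` O nU.1).
    by apply: open_nbhs_nbhs; split => //; exact: openI.
  have [W Wx WU] := compact_regular hT cT filterT nx.
  exists W° => _; split; first by split; [exists x|exact: open_interior].
  exact: subset_trans (closureS (@interior_subset _ W)) WU.
have [f hf] := choice step.
pose fix V n := if n is m.+1 then f (m, V m) else D.
have gV n : good (V n) by elim: n => [//|n /(hf (n, V n))[]].
have clV n : closure (V n.+1) `<=` V n `&` O n by have [] := hf (n, V n) (gV n).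
have decV n k : V (n + k)%N `<=` V n.
  elim: k => [|k ih]; rewrite ?addn0// addnS => x Vx.
  by apply: ih; have [] := clV _ x (subset_closure Vx).
have [a aV] := choice (fun n => (gV n).1).
have [z [_ az]] := cT (a @ \oo) _ filterT.
have zV n : closure (V n) z.
  move=> B Bz; apply: az => //.
  exists n => // m /= nm; have := aV m; rewrite -(subnKC nm); exact: decV.
exists z; split; first by have [] := clV 0%N z (zV 1%N).
by move=> n _; have [] := clV n z (zV n.+1).
Qed.

(** * Balls and finite nets *)

Section metric.
Context (R : realType) (X : metricType R).

Lemma mdist_ball_open (x : X) (r : R) : open [set y | mdist x y < r].
Proof.
rewrite openE => y /= xy; rewrite /interior.
rewrite -metricType_numDomainType.filter_from_mdist_nbhs.
exists (r - mdist x y); rewrite ?subr_gt0// => z /= yz.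
by rewrite (le_lt_trans (metric_triangle x y z))// -ltrBrDl.
Qed.

Lemma open_mdist_le (W : set X) (w : X) : open W -> W w ->
  exists2 e : R, 0 < e & forall z, mdist w z <= e -> W z.
Proof.
rewrite openE => /[apply]; rewrite /interior.
rewrite -metricType_numDomainType.filter_from_mdist_nbhs => -[e e0 eW].
exists (e / 2); first exact: divr_gt0.
move=> z wz; apply: eW; apply: le_lt_trans wz _.
by rewrite ltr_pdivrMr// ltr_pMr// ltr1n.
Qed.

Lemma compact_finite_net (r : R) : compact [set: X] -> 0 < r ->
  exists s : seq X, forall y, exists2 z, z \in s & mdist z y < r.
Proof.
move=> compactX r0; have [[p]|X0] := pselect (inhabited X); last first.
  by exists [::] => y; case: X0; exists.
pose Xp : ptopologicalType := HB.pack X (isPointed.Build X p).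
have /(_ X setT (fun z => [set y | mdist z y < r])) : cover_compact [set: Xp].
  by rewrite -compact_cover.
case.
- by move=> z _; exact: mdist_ball_open.
- by move=> y _; exists y => //=; rewrite mdistxx.
move=> D _ XD; exists (finmap.enum_fset D) => y.
by have [z zD zy] := XD y I; exists z.
Qed.

End metric.

(** * From topological transitivity to a dense orbit *)

Section flow.
Context (R : realType) (X : metricType R) (phi : X * R -> X).
Context (flow_phi : is_flow phi).

Definition reaches (T : R) (V : set X) : set X :=
  [set x | exists2 t, T <= t & V (phi (x, t))].

(** Visits are required at arbitrarily late times, because limit points in
[omega] are taken along times that tend to infinity. *)
Definition topologically_transitive : Prop :=
  forall T (V : set X), open V -> V !=set0 -> dense (reaches T V).

Lemma open_reaches (T : R) (V : set X) : open V -> open (reaches T V).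
Proof.
move=> oV.
have -> : reaches T V = \bigcup_(t in [set t | T <= t])
    (fun x => phi (x, t)) @^-1` V by [].
apply: bigcup_open => t _; apply: open_comp => // x _.
have [c _ _] := flow_phi.
apply: (@continuous_comp X (X * R)%type X (pair^~ t) phi); last exact: c.
apply: (@cvg_pair X X R (nbhs x) (nbhs x) (nbhs t)).
  exact: cvg_id.
exact: cvg_cst.
Qed.

(** Finiteness of [s] matters: dense open sets are stable under finite
intersections only, and there is one set [reaches T V] for each ball [V]. *)
Lemma dense_reaches_all (T r : R) (s : seq X) :
  0 < r -> topologically_transitive ->
  let O := [set x | forall y, y \in s ->
                    reaches T [set z | mdist y z < r] x] in
  open O /\ dense O.
Proof.
move=> r0 tt; elim: s => [|y s /= [oO dO]] /=.
  have -> : [set x | forall y, y \in [::] ->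
      reaches T [set z | mdist y z < r] x] = setT by apply/seteqP; split.
  by split; [exact: openT|move=> U; rewrite setIT].
set O := [set _ | _] in oO dO.
have -> : [set x | forall z, z \in y :: s ->
      reaches T [set z0 | mdist z z0 < r] x] =
    reaches T [set z | mdist y z < r] `&` O.
  apply/seteqP; split => x /=.
    move=> h; split; first by apply: h; rewrite mem_head.
    by move=> z zs; apply: h; rewrite inE zs orbT.
  by move=> [h hO] z; rewrite inE => /predU1P[->//|]; exact: hO.
have oy := @open_reaches T _ (mdist_ball_open y r).
split; first exact: openI.
apply: denseI => //; apply: tt; first exact: mdist_ball_open.
by exists y; rewrite /= mdistxx.
Qed.

(** A Baire point for finite nets of mesh [r n = 1 / (n + 1)] and waiting times
[n] comes within [2 * r n] of every [y] at some time [t n >= n], and these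
times witness that [y] is in its omega-limit set. *)
Lemma topologically_transitive_transitive :
  compact [set: X] -> [set: X] !=set0 ->
  topologically_transitive -> transitive_flow phi.
Proof.
move=> cX X0 tt.
pose r (n : nat) : R := n.+1%:R^-1.
have r0 n : 0 < r n by rewrite invr_gt0.
have [s hs] := choice (fun n => compact_finite_net cX (r0 n)).
have := compact_hausdorff_Baire (@metric_hausdorff _ X) cX
  (fun n => dense_reaches_all n%:R (s n) (r0 n) tt).
move=> /(_ setT X0 openT)[x [_ hx]].
exists x; apply/seteqP; split => // y _.
have near n : exists t, n%:R <= t /\ mdist y (phi (x, t)) < r n + r n.
  have [z zs zy] := hs n y.
  have [t nt zt] := hx n I z zs.
  exists t; split => //; apply: le_lt_trans (metric_triangle y z _) _.
  by rewrite ltrD// metric_sym.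
have [t ht] := choice near.
exists t.
  apply/cvgryPge => A; near=> n.
  apply: le_trans (ht n).1; near: n; exact: nbhs_infty_ger.
apply/metricType_numDomainType.cvgrPdist_lt => e e0.
have e20 : 0 < e / 2 by rewrite divr_gt0.
near=> n.
apply: lt_le_trans (ht n).2 _.
have : r n < e / 2.
  by near: n; exact: (near_infty_natSinv_lt (PosNum e20)).
by move=> rn; rewrite [leRHS]splitr ltW// ltrD.
Unshelve. all: by end_near. Qed.

(** * Chains *)

Definition chained (delta T : R) (p q : X) : Prop :=
  exists m c, [/\ (0 < m)%N, chain phi delta T m c,
                  (c 0%N).1 = p & (c m).1 = q].

Lemma relatedP delta T p q :
  related phi delta T p q <-> chained delta T p q /\ chained delta T q p.
Proof.
split.
  move=> [m [n [c [e [[m0 n0] hc he [p1 p2] [q1 q2]]]]]].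
  by split; [exists m, c|exists n, e].
move=> [[m [c [m0 hc p1 q1]]] [n [e [n0 he q2 p2]]]].
by exists m, n, c, e.
Qed.

(** The two jumps: follow [p] for time [T], jump to a point [phi (x, a)] of the
orbit with full omega-limit set, follow it until a time [b >= a + T] at which it
is close to [q], and jump to [q]. *)
Lemma transitive_chained delta T p q : 0 < delta -> transitive_flow phi ->
  chained delta T p q.
Proof.
move=> d0 [x wx].
have visit A y : exists2 t, A <= t & mdist (phi (x, t)) y <= delta.
  have : omega phi x y by rewrite wx.
  move=> [t /cvgryPge /(_ A) tA].
  move=> /metricType_numDomainType.cvgr_dist_le/(_ _ d0) ty.
  have [n [nA ny]] := filter_ex (filterI tA ty).
  by exists (t n) => //; rewrite metric_sym.
have [a _ ha] := visit 0 (phi (p, T)).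
have [b ab hb] := visit (a + T) q.
have [_ _ phiD] := flow_phi.
exists 2%N, (nth (q, 0) [:: (p, T); (phi (x, a), b - a)]); split => //.
move=> [|[|]]//= _; split => //; first by rewrite metric_sym.
  by rewrite lerBrDl.
by rewrite phiD subrKC.
Qed.

Lemma chain_cat (delta T : R) m n c e :
  chain phi delta T m c -> chain phi delta T n e -> (c m).1 = (e 0%N).1 ->
  chain phi delta T (m + n)
    (fun i => if (i < m)%N then c i else e (i - m)%N).
Proof.
move=> hc he ce i imn; have [im|mi] := ltnP i m.
  have [h1 h2] := hc i im; split => //.
  have [//|mi] := ltnP i.+1 m.
  have im1 : i.+1 = m by apply/eqP; rewrite eqn_leq im mi.
  by rewrite im1 subnn -ce -im1.
have im : (i - m < n)%N by rewrite ltn_subLR.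
have [h1 h2] := he _ im.
by split => //; rewrite ltnNge (leq_trans mi)//= subSn.
Qed.

(** * Shadowing periodic pseudo-orbits *)

Lemma periodic_pseudo_orbit delta T m c : (0 < m)%N ->
  chain phi delta T m c -> (c m).1 = (c 0%N).1 ->
  pseudo_orbit phi delta T (fun i => c `|(i %% m)%Z|%N).
Proof.
move=> m0 hc cm i.
have m0' : (0 < m%:Z)%R by [].
have -> : ((i + 1) %% m)%Z = ((`|(i %% m)%Z|.+1 %% m)%N : int).
  rewrite -modz_nat -addn1 PoszD gez0_abs ?modz_ge0 ?lt0r_neq0//.
  by rewrite modzDml.
set r := `|(i %% m)%Z|%N.
have rm : (r < m)%N.
  by rewrite -ltz_nat gez0_abs ?modz_ge0 ?lt0r_neq0// ltz_pmod.
have [h1 h2] := hc r rm; split => //=.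
move: (rm); rewrite leq_eqVlt => /predU1P[e|lt]; last by rewrite modn_small.
by rewrite e modnn -cm -e.
Qed.

(** Each jump point lies on the trajectory of its pseudo-orbit, hence is tracked
by every shadowing orbit. *)
Lemma star_partial_time delta T c i : 0 < T -> pseudo_orbit phi delta T c ->
  star phi c (partial_time c i) = (c i).1.
Proof.
move=> T0 hc; rewrite (star_phiE T0 hc (i := i)).
  by have [_ phi0 _] := flow_phi; rewrite subrr phi0.
by rewrite lexx partial_timeS ltrDl (lt_le_trans T0)// (hc i).1.
Qed.

(** The trajectory of a pseudo-orbit reaches its [n]-th jump point no earlier than
at time [T *+ n]; in a periodic one, for [T > 0], a given point therefore recurs
at arbitrarily late times. *)
Lemma partial_time_ge delta T c (n : nat) : pseudo_orbit phi delta T c ->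
  T *+ n <= partial_time c n.
Proof.
move=> hc; elim: n => [|n ih]; first by rewrite /= big_nil.
by rewrite -addn1 PoszD partial_timeS mulrnDr lerD// (hc n).1.
Qed.

(** The loop [p], [x], [y], [p], repeated periodically, is shadowed by the orbit
of some [z]. As the time change [h] may slow it down, a single passage from [x]
to [y] need not last for time [T]; waiting for a later visit to [y] makes the
elapsed time as large as required. *)
Lemma shadowable_topologically_transitive p :
  shadowable phi p -> chain_transitive phi -> topologically_transitive.
Proof.
move=> shp ct T V oV [y Vy] U [x Ux] oU.
have [e e0 [eU eV]] : exists2 e, 0 < e &
    (forall z, mdist x z <= e -> U z) /\ (forall z, mdist y z <= e -> V z).
  have [a a0 aU] := open_mdist_le oU Ux; have [b b0 bV] := open_mdist_le oV Vy.
  exists (Num.min a b); first by rewrite lt_min a0.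
  by split => z; rewrite le_min => /andP[]; [move=> /aU|move=> _ /bV].
have [delta d0 sh] := shp e e0.
have chn u v : chained delta 1 u v.
  by have /relatedP[] := ct u v delta 1 d0 ltr01.
have [m [c [m0 hc c0 cm]]] := chn p x.
have [n [c' [n0 hc' c'0 c'n]]] := chn x y.
have [k [c'' [k0 hc'' c''0 c''k]]] := chn y p.
(* The loop [l] has length [M]; it is at [x] for index [m], at [y] for index
   [m + n]. *)
have hcc := chain_cat hc hc' (etrans cm (esym c'0)).
set a := fun i : nat => _ in hcc.
have amn : (a (m + n)%N).1 = y by rewrite /a ltnNge leq_addr /= addKn.
have hl := chain_cat hcc hc'' (etrans amn (esym c''0)).
set l := fun i : nat => _ in hl.
have lx : (l m).1 = x by rewrite /l -addn1 leq_add2l n0 /a ltnn subnn.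
have ly : (l (m + n)%N).1 = y by rewrite /l ltnn subnn.
have lp : (l (m + n + k)%N).1 = p by rewrite /l ltnNge leq_addr /= addKn.
have l0 : (l 0%N).1 = p by rewrite /l addn_gt0 m0 /= /a m0.
set M := (m + n + k)%N in hl lp.
have M0 : (0 < M)%N by rewrite !addn_gt0 m0.
have hP := periodic_pseudo_orbit M0 hl (etrans lp (esym l0)).
set P := fun i : int => _ in hP.
have Px : (P m).1 = x.
  by rewrite /P modz_nat modn_small ?lx//
    /M -addnA -addn1 leq_add2l addn_gt0 n0.
have Py (j : nat) : (P (j * M + (m + n))%N).1 = y.
  by rewrite /P modz_nat modnMDl modn_small ?ly//
    /M -addn1 leq_add2l.
have P0 : (P 0).1 = p by rewrite /P mod0z l0.
have [z [h [[hsurj hmono _] hz]]] := sh P hP P0.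
have [_ _ phiD] := flow_phi.
set tx := h (partial_time P m).
have [u _ hu] := hsurj (tx + T) I.
(* [u] is the star time from which on [h] exceeds [tx + T]; step times are at
   least [1], so the visit to [y] in the period [j > u] comes after [u]. *)
pose j := (Num.truncn u).+1.
have uj : u < partial_time P (j * M + (m + n))%N.
  apply: lt_le_trans (partial_time_ge _ hP).
  apply: lt_le_trans (truncnS_gt u) _.
  by rewrite ler_nat (leq_trans (leq_pmulr _ M0))// leq_addr.
set ty := h (partial_time P (j * M + (m + n))%N).
exists (phi (z, tx)); split.
  apply: eU; have := hz (partial_time P m).
  by rewrite (star_partial_time _ ltr01 hP) Px.
exists (ty - tx).
  by rewrite lerBrDl -hu ltW// hmono.
rewrite phiD subrKC; apply: eV.
have := hz (partial_time P (j * M + (m + n))%N).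
by rewrite (star_partial_time _ ltr01 hP) Py.
Qed.

End flow.

(** * The equivalence *)

Theorem theorem2p15 (R : realType) (X : metricType R) (phi : X * R -> X)
    (compactX : compact [set: X]) (flow_phi : is_flow phi)
    (Sh_phi : Sh phi !=set0) :
  chain_transitive phi <-> transitive_flow phi.
Proof.
split=> [ct|tr p q delta T d0 _].
  have [p shp] := Sh_phi.
  apply: topologically_transitive_transitive => //; first by exists p.
  exact: shadowable_topologically_transitive shp ct.
by apply/relatedP; split; exact: transitive_chained.
Qed.
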